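(* Let $A,B\in\mathbb{C}^{N\times N}$, let $\omega>0$, $\Delta t>0$ with $\sin(\omega\Delta t)\ne0$, and let $$\alpha=\frac{(\omega\Delta t)^2}{2-2\cos(\omega\Delta t)},\qquad \beta=\frac{\omega\Delta t}{\sin(\omega\Delta t)} .$$ Let $U,F\in\mathbb{C}^N$ and set $u_n=e^{i\omega n\Delta t}U$, $f_n=e^{i\omega n\Delta t}F$ for $n\in\mathbb{Z}$. Then $$(-\omega^2I+i\omega B+A)U=F$$ if and only if $u_n,f_n$ satisfy $$\frac{1}{\Delta t^2}(u_{n+1}-2u_n+u_{n-1})+\frac{\hat B}{\Delta t}(u_n-u_{n-1})+\hat A u_n=\alpha^{-1}f_n\qquad(n\in\mathbb{Z}),$$ where $$\hat A=\alpha^{-1}A-\frac{\beta(1-\cos(\omega\Delta t))}{\alpha\,\Delta t}B,\qquad \hat B=\alpha^{-1}\beta B .$$ *)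

(* Defs.v *)
From mathcomp Require Import all_boot all_order all_algebra.
From mathcomp Require Import ring.
From mathcomp Require Import complex.
From mathcomp Require Import reals sequences exp trigo.

Set Implicit Arguments.
Unset Strict Implicit.
Unset Printing Implicit Defensive.

Import Order.TTheory GRing.Theory Num.Theory.

Local Open Scope ring_scope.
Local Open Scope complex_scope.

(* exp (x + i y) = exp x (cos y + i sin y), where [expR], [cos] and [sin] are
   the power series over [R]. *)
Definition cexp (R : realType) (z : R[i]) : R[i] :=
  let: x +i* y := z in (expR x * cos y) +i* (expR x * sin y).

Lemma cexp_real (R : realType) (x : R) : cexp x%:C = (expR x)%:C.
Proof. by rewrite /cexp [LHS]/= cos0 sin0 mulr1 mulr0. Qed.

Lemma cexpD (R : realType) (z w : R[i]) : cexp (z + w) = cexp z * cexp w.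
Proof.
case: z w => [a b] [c d]; rewrite /cexp.
rewrite [X in X = _]/= expRD cosD sinD; congr Complex; ring.
Qed.

(* Main.v *)
(* Writing t = omega * dt, one has u_{n+1} = (cos t + i sin t) u_n and
   u_{n-1} = (cos t - i sin t) u_n. The scaling by alpha and beta is chosen so
   that the left-hand side of the scheme at step n is exactly
   alpha^-1 e^{i omega n dt} times (- omega^2 I + i omega B + A) U, and that
   scalar factor never vanishes. *)

Require Import Defs.
From mathcomp Require Import all_boot all_order all_algebra.
From mathcomp Require Import ring.
From mathcomp Require Import complex.
From mathcomp Require Import reals sequences exp trigo.

Import Order.TTheory GRing.Theory Num.Theory.

Local Open Scope ring_scope.
Local Open Scope complex_scope.

Lemma cexp_neq0 (R : realType) (z : R[i]) : cexp z != 0.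
Proof.
have e1 : cexp z * cexp (- z) = 1.
  by rewrite -cexpD subrr -[0 in LHS]/(0%:C) cexp_real expR0.
by apply/eqP => z0; move/eqP: e1; rewrite z0 mul0r eq_sym oner_eq0.
Qed.

Lemma cexp_imaginary (R : realType) (x : R) :
  cexp ('i%C * x%:C) = (cos x)%:C + 'i%C * (sin x)%:C.
Proof.
by simpc; rewrite /cexp [LHS]/= expR0 !mul1r.
Qed.

(** By the Pythagorean identity, [cos x = 1] would force [sin x ^+ 2 = 0]. This keeps the
    denominator of [alpha] away from zero. *)
Lemma cos_neq1 (R : realType) (x : R) : sin x != 0 -> cos x != 1.
Proof.
move=> sx; apply/eqP => cx; move: (cos2Dsin2 x); rewrite cx expr1n.
by move/eqP; rewrite addrC -subr_eq0 addrK sqrf_eq0 (negbTE sx).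
Qed.

(* The scheme applied to a sequence with u_{n+1} = (c + j s) u_n and
   u_{n-1} = (c - j s) u_n; neither c^2 + s^2 = 1 nor j^2 = -1 is involved. *)
Lemma scheme_factor (K : fieldType) (N : nat) (A B : 'M[K]_N) (U : 'cV[K]_N)
    (w d c s j e : K) :
  w != 0 -> d != 0 -> s != 0 -> 2 - 2 * c != 0 ->
  let alpha := (w * d) ^+ 2 / (2 - 2 * c) in
  let beta := w * d / s in
  (1 / d ^+ 2) *: ((e * (c + j * s)) *: U - 2 *: (e *: U)
                   + (e * (c - j * s)) *: U)
  + ((1 / d) *: ((alpha^-1 * beta) *: B))
      *m (e *: U - (e * (c - j * s)) *: U)
  + (alpha^-1 *: A - (beta * (1 - c) / (alpha * d)) *: B) *m (e *: U)
  = (alpha^-1 * e) *: (((- w ^+ 2) *: 1%:M + (j * w) *: B + A) *m U).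
Proof.
move=> w0 d0 s0 c0 alpha beta.
rewrite !mulmxDl !mulNmx -!scalemxAl mul1mx -!scalerBl -!scalemxAr.
apply/matrixP => i k; rewrite !mxE.
(* The entries of [U], [A *m U] and [B *m U] become independent atoms. In the [B] part, the
   subtracted term cancels the [1 - c] of the backward difference, leaving [j * s], and
   [beta * s / d = w]. *)
move: (U i k) (\sum_l A i l * U l k) (\sum_l B i l * U l k) => x y z.
by rewrite /alpha /beta; field; rewrite d0 s0 c0 w0.
Qed.

Theorem proposition4 (R : realType) (N : nat) (A B : 'M[R[i]]_N)
    (omega dt : R) (omega_gt0 : 0 < omega) (dt_gt0 : 0 < dt)
    (sin_neq0 : sin (omega * dt) <> 0) (U F : 'cV[R[i]]_N) :
  let alpha : R := (omega * dt) ^+ 2 / (2 - 2 * cos (omega * dt)) in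
  let beta : R := omega * dt / sin (omega * dt) in
  let u : int -> 'cV[R[i]]_N :=
    fun n => cexp ('i%C * (omega * n%:~R * dt)%:C) *: U in
  let f : int -> 'cV[R[i]]_N :=
    fun n => cexp ('i%C * (omega * n%:~R * dt)%:C) *: F in
  let Ahat : 'M[R[i]]_N :=
    (alpha^-1)%:C *: A
    - (beta * (1 - cos (omega * dt)) / (alpha * dt))%:C *: B in
  let Bhat : 'M[R[i]]_N := (alpha^-1 * beta)%:C *: B in
  ((- (omega ^+ 2)%:C) *: 1%:M + ('i%C * omega%:C) *: B + A) *m U = F
  <->
  (forall n : int,
     (1 / dt ^+ 2)%:C *: (u (n + 1) - 2 *: u n + u (n - 1))
     + ((1 / dt)%:C *: Bhat) *m (u n - u (n - 1))
     + Ahat *m u n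
     = (alpha^-1)%:C *: f n).
Proof.
move=> alpha beta u f Ahat Bhat.
have w0 : omega%:C != 0 by rewrite fmorph_eq0 gt_eqF.
have d0 : dt%:C != 0 by rewrite fmorph_eq0 gt_eqF.
have sR0 : sin (omega * dt) != 0 by apply/eqP.
have s0 : (sin (omega * dt))%:C != 0 by rewrite fmorph_eq0.
have c0 : 2 - 2 * (cos (omega * dt))%:C != 0.
  rewrite -[X in X - _]mulr1 -mulrBr mulf_neq0 ?pnatr_eq0 //.
  by rewrite subr_eq0 -[1]/(1%:C) eq_sym (inj_eq (fmorph_inj _)) cos_neq1.
have alphaC : alpha%:C
    = (omega%:C * dt%:C) ^+ 2 / (2 - 2 * (cos (omega * dt))%:C).
  by rewrite /alpha fmorph_div rmorphXn rmorphB !rmorphM /= !rmorph_nat.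
have alpha0 : alpha%:C != 0.
  by rewrite alphaC mulf_neq0 ?invr_neq0 ?expf_neq0 ?mulf_neq0.
have betaC : beta%:C = omega%:C * dt%:C / (sin (omega * dt))%:C.
  by rewrite /beta fmorph_div rmorphM.
(* From here on [alpha] and [beta] are known only through [alphaC], [alpha0] and [betaC], all stated
   in [R[i]]. *)
clearbody alpha beta.
pose e (n : int) := cexp ('i%C * (omega * n%:~R * dt)%:C).
have e_succ n : e (n + 1)
    = e n * ((cos (omega * dt))%:C + 'i%C * (sin (omega * dt))%:C).
  rewrite -cexp_imaginary -cexpD -mulrDr -rmorphD /e intrD.
  by congr (cexp (_ * _%:C)); ring.
have e_pred n : e (n - 1)
    = e n * ((cos (omega * dt))%:C - 'i%C * (sin (omega * dt))%:C).
  (* Parity of [cos] and [sin] turns the conjugate factor into [cexp] at the angle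
     [- (omega * dt)]. *)
  rewrite -mulrN -rmorphN -[cos _]cosN -sinN -cexp_imaginary -cexpD -mulrDr.
  by rewrite -rmorphD /e intrB; congr (cexp (_ * _%:C)); ring.
set L := (_ + A) *m U.
have key n : (1 / dt ^+ 2)%:C *: (u (n + 1) - 2 *: u n + u (n - 1))
     + ((1 / dt)%:C *: Bhat) *m (u n - u (n - 1)) + Ahat *m u n
     = ((alpha^-1)%:C * e n) *: L.
  rewrite /u -!/(e _) e_succ e_pred /Ahat /Bhat /L.
  rewrite !(rmorphM, rmorphB, rmorph1, fmorphV) /= -!expr2.
  by rewrite alphaC betaC; exact: scheme_factor.
split=> [LF n|scheme]; first by rewrite key LF scalerA.
(* The converse is read off at [n = 0]: both sides carry the same scalar [alpha^-1 * e 0], which is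
   nonzero and cancels. *)
have := scheme 0; rewrite key -[f 0]/(e 0 *: F) scalerA.
by apply: scalerI; rewrite mulf_neq0 ?cexp_neq0 // fmorphV invr_neq0.
Qed.
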